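(* Let $d\geq 1$ and let $V_d$ be a $k$-vector space of dimension $d$. Then $\dim_k\left(\Lambda^{S^3}_{V_d}[3d]\right)\geq 1$.
   Context: $k$ is a field of characteristic zero and $\otimes=\otimes_k$. For $n\ge 0$ let $\mathcal{T}^{S^3}_{V_d}[n]=V_d^{\otimes\binom{n}{3}}$, with tensor factors indexed by triples $1\leq i<j<l\leq n$. Let $\mathcal{E}^{S^3}_{V_d}[n]\subseteq \mathcal{T}^{S^3}_{V_d}[n]$ be the subspace linearly generated by the simple tensors $\otimes_{1\leq i<j<l\leq n}(v_{i,j,l})$ for which there exist $1\leq x<y<z<t\leq n$ with $v_{x,y,z}=v_{x,y,t}=v_{x,z,t}=v_{y,z,t}$. Then $\Lambda^{S^3}_{V_d}[n]=\mathcal{T}^{S^3}_{V_d}[n]/\mathcal{E}^{S^3}_{V_d}[n]$. *)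

(* Defs.v *)
From HB Require Import structures.
From Stdlib Require Import ClassicalEpsilon.
From mathcomp Require Import all_boot all_order all_algebra.
Set Implicit Arguments.
Unset Strict Implicit.
Unset Printing Implicit Defensive.
Import GRing.Theory.
Local Open Scope ring_scope.

(* The set S of generators is an arbitrary, possibly infinite Prop-valued set,
   so its span is obtained as a {vspace _} by classical choice; span_ofP is its
   characterization. *)
Section SpanOf.
Variables (k : fieldType) (vT : vectType k) (S : vT -> Prop).

Definition lincomb (x : vT) : Prop :=
  exists2 X : seq vT, (forall u, u \in X -> S u) & x \in <<X>>%VS.

Lemma span_of_exists : exists U : {vspace vT}, forall x, x \in U <-> lincomb x.
Proof.
suff [X SX maxX]: exists2 X : seq vT, (forall u, u \in X -> S u) &
    forall u, S u -> u \in <<X>>%VS.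
  exists <<X>>%VS => x; split=> [xX|[Y SY xY]]; first by exists X.
  by apply: subvP xY; apply/span_subvP => u /SY/maxX.
have [//|noX] := classic (exists2 X : seq vT, (forall u, u \in X -> S u) &
    forall u, S u -> u \in <<X>>%VS).
have grow n : exists2 X : seq vT, (forall u, u \in X -> S u) &
    (n <= \dim <<X>>)%N.
  elim: n => [|n [X SX dX]]; first by exists [::].
  have [//|noY] := classic (exists2 X : seq vT, (forall u, u \in X -> S u) &
    (n.+1 <= \dim <<X>>)%N).
  case: noX; exists X => // u Su; apply: contraT => uX; case: noY.
  exists (u :: X); first by move=> w; rewrite inE => /predU1P[->|/SX].
  apply: leq_ltn_trans dX _; rewrite span_cons.
  rewrite ltn_neqAle dimvS ?addvSr // andbT.
  rewrite (dimv_leqif_sup (addvSr _ _)).2 subv_add -memvE.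
  by rewrite negb_and uX.
have [X _] := grow (\dim {:vT}).+1.
by rewrite ltnNge dimvS ?subvf.
Qed.

Definition span_of : {vspace vT} :=
  proj1_sig (constructive_indefinite_description _ span_of_exists).

Lemma span_ofP x : x \in span_of <-> lincomb x.
Proof. by rewrite /span_of; case: constructive_indefinite_description. Qed.

End SpanOf.

Import VectorInternalTheory.

Section QuotientSpace.
Variables (k : fieldType) (vT : vectType k) (U : {vspace vT}).

(* The additive group of vT / U is MathComp's quotient by an additive
   subgroup; only the scaling and the finite-dimensionality are added. *)
Definition quotv : predArgType := Quotient.quot U.
HB.instance Definition _ := GRing.Zmodule.on quotv.

Definition quotv_pi (x : vT) : quotv := \pi_(Quotient.quot U)%qT x.

Definition quotv_repr (q : quotv) : vT := repr (q : Quotient.quot U).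

Lemma quotv_reprK : cancel quotv_repr quotv_pi.
Proof. by move=> q; exact: reprK. Qed.

Lemma quotv_pi_eq x y : (quotv_pi x == quotv_pi y) = (x - y \in U).
Proof. by rewrite Quotient.idealrBE. Qed.

Lemma quotv_piD x y : quotv_pi (x + y) = quotv_pi x + quotv_pi y.
Proof. by rewrite /quotv_pi [LHS]raddfD. Qed.

Definition quotv_scale (a : k) (q : quotv) : quotv :=
  quotv_pi (a *: quotv_repr q).

Lemma quotv_scale_pi a x : quotv_scale a (quotv_pi x) = quotv_pi (a *: x).
Proof.
apply/eqP; rewrite quotv_pi_eq -scalerBr memvZ // -quotv_pi_eq.
by rewrite quotv_reprK.
Qed.

Fact quotv_scaleA a b q :
  quotv_scale a (quotv_scale b q) = quotv_scale (a * b) q.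
Proof. by rewrite -[q]quotv_reprK !quotv_scale_pi scalerA. Qed.

Fact quotv_scale1 : left_id 1 quotv_scale.
Proof. by move=> q; rewrite -[q]quotv_reprK quotv_scale_pi scale1r. Qed.

Fact quotv_scaleDr : right_distributive quotv_scale +%R.
Proof.
move=> a q r; rewrite -[q]quotv_reprK -[r]quotv_reprK.
by rewrite -quotv_piD !quotv_scale_pi -quotv_piD scalerDr.
Qed.

Fact quotv_scaleDl q : {morph quotv_scale^~ q : a b / a + b}.
Proof.
by move=> a b; rewrite -[q]quotv_reprK !quotv_scale_pi scalerDl quotv_piD.
Qed.

HB.instance Definition _ := GRing.Zmodule_isLmodule.Build k quotv
  quotv_scaleA quotv_scale1 quotv_scaleDr quotv_scaleDl.

Fact quotv_pi_is_linear : linear quotv_pi.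
Proof.
by move=> a x y; rewrite quotv_piD -quotv_scale_pi.
Qed.
HB.instance Definition _ := GRing.isSemilinear.Build k vT quotv _ quotv_pi
  (GRing.semilinear_linear quotv_pi_is_linear).

Definition quotv_coord (q : quotv) : subvs_of U^C :=
  vsproj U^C (quotv_repr q - projv U (quotv_repr q)).

Lemma quotv_coord_pi x : quotv_coord (quotv_pi x) = vsproj U^C (x - projv U x).
Proof.
set r := quotv_repr (quotv_pi x).
have rU : projv U (r - x) = r - x.
  by rewrite projv_id // -quotv_pi_eq quotv_reprK.
rewrite /quotv_coord -/r; congr (vsproj _ _).
have -> : projv U r = r - x + projv U x by rewrite -rU linearB subrK.
by rewrite opprD opprB addrA addrCA subrr addr0.
Qed.

Lemma quotv_pi_coord q : quotv_pi (vsval (quotv_coord q)) = q.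
Proof.
rewrite vsprojK ?memv_projC // -[RHS]quotv_reprK; apply/eqP.
by rewrite quotv_pi_eq addrAC subrr sub0r memvN memv_proj.
Qed.

Fact quotv_vect_iso : Vector.axiom (\dim U^C) quotv.
Proof.
exists (fun q => v2r (quotv_coord q)) => [a q r|].
  rewrite -[q]quotv_reprK -[r]quotv_reprK -(linearP quotv_pi) !quotv_coord_pi.
  set p := quotv_repr q; set s := quotv_repr r.
  suff -> : a *: p + s - projv U (a *: p + s) =
            a *: (p - projv U p) + (s - projv U s) by rewrite !linearP.
  by rewrite linearP scalerBr opprD addrACA.
exists (fun rw => quotv_pi (vsval (r2v rw : subvs_of U^C))) => [q|rw] /=.
  by rewrite v2rK quotv_pi_coord.
rewrite quotv_coord_pi; set u := r2v rw.
have -> : projv U (vsval u) = 0.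
  by apply/eqP; rewrite -memv_ker lker_proj subvsP.
by rewrite subr0 vsvalK r2vK.
Qed.

HB.instance Definition _ := Lmodule_hasFinDim.Build k quotv quotv_vect_iso.

Lemma quotv_pi0 x : (quotv_pi x == 0) = (x \in U).
Proof. by rewrite -[0](linear0 quotv_pi) quotv_pi_eq subr0. Qed.

Lemma dim_quotv : \dim {:quotv} = (\dim {:vT} - \dim U)%N.
Proof.
by rewrite -dimv_compl dimvf.
Qed.

End QuotientSpace.

Section TensorPower.
Variables (k : fieldType) (I : finType) (V : vectType k).

Definition upd (T : Type) (v : {ffun I -> T}) (i : I) (x : T) : {ffun I -> T} :=
  [ffun j => if j == i then x else v j].

Definition multilinear (W : lmodType k) (f : {ffun I -> V} -> W) : Prop :=
  forall (v : {ffun I -> V}) (i : I), linear (fun x => f (upd v i x)).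

(* The tensor product of copies of V indexed by I, in coordinates with respect
   to the basis of V: a tensor is its array of coefficients on the products of
   basis vectors. That it is the tensor power of V, and that pure is the map
   v |-> (x)_i (v i), is the universal property pure_multilinear,
   tensor_universal below. *)
Definition tensor : predArgType :=
  {ffun {ffun I -> 'I_(\dim {:V})} -> k^o}.
HB.instance Definition _ := SemiVector.on tensor.
HB.instance Definition _ := Vector.on tensor.

Definition pure (v : {ffun I -> V}) : tensor :=
  [ffun c : {ffun I -> 'I_(\dim {:V})} =>
     \prod_(i : I) coord (vbasis {:V}) (c i) (v i)].

Lemma pure_multilinear : multilinear pure.
Proof.
move=> v i a x y; apply/ffunP=> c; rewrite !ffunE.
rewrite !(bigD1 (P := predT) i) //= !ffunE !eqxx linearP mulrDl /=.
rewrite /GRing.scale /= mulrA; congr (_ * _ + _ * _);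
  by apply: eq_bigr => j /negPf ji; rewrite !ffunE ji.
Qed.

Definition basis_family (c : {ffun I -> 'I_(\dim {:V})}) : {ffun I -> V} :=
  [ffun i => (vbasis {:V})`_(c i)].

Lemma pure_basis_family c c' :
  pure (basis_family c) c' = (c' == c)%:R.
Proof.
rewrite ffunE; have [->|/eqP ne] := eqVneq.
  by apply: big1 => i _; rewrite ffunE coord_free ?eqxx ?(basis_free (vbasisP _)).
have [i ci] : exists i, c' i != c i.
  apply/existsP; rewrite -negb_forall; apply/negP=> /forallP cc.
  by case: ne; apply/ffunP=> i; apply/eqP/cc.
rewrite (bigD1 i) //= ffunE coord_free ?(basis_free (vbasisP _)) //.
by rewrite eq_sym (negPf ci) mul0r.
Qed.

Lemma tensor_basis (t : tensor) : t = \sum_c t c *: pure (basis_family c).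
Proof.
apply/ffunP=> c; rewrite sum_ffunE (bigD1 c) //= ffunE pure_basis_family eqxx.
rewrite big1 ?addr0 => [|c' ne]; first by rewrite /GRing.scale /= mulr1.
by rewrite ffunE pure_basis_family eq_sym (negPf ne) scaler0.
Qed.

Lemma multilinear_ext (W : lmodType k) (f g : {ffun I -> V} -> W) :
    multilinear f -> multilinear g ->
    (forall c, f (basis_family c) = g (basis_family c)) ->
  f =1 g.
Proof.
move=> fL gL fg v.
have : forall i, i \notin enum I -> exists j : 'I_(\dim {:V}), v i == (vbasis {:V})`_j.
  by move=> i; rewrite mem_enum.
elim: (enum I) v => [|i s IHs] v bv.
  pose c := [ffun i => xchoose (bv i isT)].
  suff -> : v = basis_family c by [].
  by apply/ffunP=> i; rewrite !ffunE; apply/eqP; exact: (xchooseP (bv i isT)).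
have sumE (h : {ffun I -> V} -> W) : multilinear h ->
    h v = \sum_(j < \dim {:V}) coord (vbasis {:V}) j (v i) *:
            h (upd v i (vbasis {:V})`_j).
  move=> hL; pose hi : {linear V -> W} := HB.pack (fun x => h (upd v i x))
    (GRing.isSemilinear.Build k V W _ (fun x => h (upd v i x))
      (GRing.semilinear_linear (hL v i))).
  have {1}-> : v = upd v i (v i).
    by apply/ffunP=> j; rewrite ffunE; case: eqP => [->|].
  rewrite -[h _]/(hi (v i)) {1}(coord_vbasis (memvf (v i))) linear_sum.
  by apply: eq_bigr => j _; rewrite linearZ.
rewrite (sumE f) // (sumE g) //; apply: eq_bigr => j _; congr (_ *: _).
apply: IHs => i' i's; rewrite ffunE; have [_|ne] := eqVneq; first by exists j.
by apply: bv; rewrite inE negb_or ne.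
Qed.

Theorem tensor_universal (W : lmodType k) (f : {ffun I -> V} -> W) :
  multilinear f ->
  exists g : {linear tensor -> W},
    (forall v, g (pure v) = f v) /\
    (forall h : {linear tensor -> W}, (forall v, h (pure v) = f v) -> h =1 g).
Proof.
move=> fL; pose g (t : tensor) := \sum_c t c *: f (basis_family c).
have gL : linear g.
  move=> a t u; rewrite /g scaler_sumr -big_split; apply: eq_bigr => c _ /=.
  by rewrite !ffunE scalerDl scalerA.
pose gl : {linear tensor -> W} := HB.pack g
  (GRing.isSemilinear.Build k tensor W _ g (GRing.semilinear_linear gL)).
have glE c : gl (pure (basis_family c)) = f (basis_family c).
  rewrite /= /g (bigD1 c) //= pure_basis_family eqxx scale1r big1 ?addr0 //.
  by move=> c' /negPf ne; rewrite pure_basis_family ne scale0r.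
exists gl; split=> [v|h hE t].
  apply: (@multilinear_ext W (gl \o pure) f) => // w i a x y.
  by rewrite /= pure_multilinear; exact: gL.
rewrite [t]tensor_basis !linear_sum; apply: eq_bigr => c _.
by rewrite !linearZ /= hE -glE.
Qed.

End TensorPower.

Section LambdaS3.
Variable k : fieldType.

Definition triple (n : nat) : predArgType :=
  {t : 'I_n * 'I_n * 'I_n | (t.1.1 < t.1.2)%N && (t.1.2 < t.2)%N}.
HB.instance Definition _ n := Finite.on (triple n).

Definition tri n (i j l : 'I_n) (ij : (i < j)%N) (jl : (j < l)%N) : triple n :=
  exist _ (i, j, l) (introT andP (conj ij jl)).

Lemma card_triple n : #|{: triple n}| = 'C(n, 3).
Proof.
rewrite -card_ltn_sorted_tuples card_sig.
pose F (t : 'I_n * 'I_n * 'I_n) : 3.-tuple 'I_n := [tuple t.1.1; t.1.2; t.2].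
have Finj : injective F by move=> [[a b] c] [[a' b'] c'] [-> -> ->].
rewrite -(card_imset _ Finj); apply: eq_card => u; rewrite !inE.
apply/imsetP/idP => [[t] | ].
  by rewrite inE => /andP[ab bc] ->; rewrite /= ab bc.
case: u => [[|a [|b [|c []]]] //= i]; rewrite andbT => abc.
by exists (a, b, c); [rewrite inE | apply: val_inj].
Qed.

Definition T_S3 (V : vectType k) (n : nat) : vectType k := tensor (triple n) V.

Definition E_S3_gen (V : vectType k) (n : nat) (u : T_S3 V n) : Prop :=
  exists v : {ffun triple n -> V},
    u = pure v /\
    exists (x y z t : 'I_n) (xy : (x < y)%N) (yz : (y < z)%N) (zt : (z < t)%N),
      let xz := ltn_trans xy yz in
      let yt := ltn_trans yz zt in
      [/\ v (tri xy yz) = v (tri xy yt),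
          v (tri xy yt) = v (tri xz zt) &
          v (tri xz zt) = v (tri yz zt)].

Definition E_S3 (V : vectType k) (n : nat) : {vspace T_S3 V n} :=
  span_of (@E_S3_gen V n).

Definition Lambda_S3 (V : vectType k) (n : nat) : vectType k :=
  quotv (E_S3 V n).

End LambdaS3.

(* Main.v *)
Require Import Defs.
From mathcomp Require Import all_boot all_order all_algebra.
From mathcomp Require Import zify ring.
Import GRing.Theory.

(* Put n = 3d. Fixing v, sum_t a_t t |-> sum_t a_t (boundary t) (x) v_t is a linear
   map from the 2-chains of the full simplex on n vertices to V-valued 1-chains,
   with one matrix row per triple t, linear in v_t. Composing with a fixed map P
   back to the 2-chains and taking the determinant gives a multilinear function of
   v; it vanishes on the generators of E_S3, because the boundary of a tetrahedron
   with constant v on its faces lies in the kernel. If v takes values in a basis of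
   V, v is a coloring of the triples by d colors, and the map is injective as soon
   as no color class supports a nonzero 2-cycle; P can then be chosen so that the
   determinant is 1. Such a coloring is given by an explicit formula, for which
   every color class can be emptied by repeatedly removing a triple having an edge
   that lies in no other remaining triple of the class. *)

(* The vertices form d blocks of 3, the vertex u being the element u %% 3 of the
   block u %/ 3. The coloring is built block by block: when the block l is added,
   the color l takes its triangle and the cones over one third of the older edges
   (those with b - a = e mod 3, or with b - a replaced by the missing element of the
   block when both ends lie in one block); the triples added to an older color are
   cones over trees. *)
Definition triple_color (u v w : nat) : nat :=
  let i := u %/ 3 in let j := v %/ 3 in let l := w %/ 3 in
  let a := u %% 3 in let b := v %% 3 in let e := w %% 3 in
  let p := (b + 2 * a + 2 * e) %% 3 in
  if i == j then if a + b + e == 3 then l else i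
  else if j == l then if a + b + e == 3 then i else l
  else if p == 0 then l else if p == 1 then i else j.

Lemma triple_color_bound d u v w :
  u < 3 * d -> v < 3 * d -> w < 3 * d -> triple_color u v w < d.
Proof. by rewrite /triple_color => *; do !case: ifP => _; lia. Qed.

(** * Removing all triples of one color class *)

Section Collapse.
(** [Z u v w] reads: this triple is not in class [c] or is already removed. [Zcollapse] is one
    removal, along the free edge [u v]. *)
Variables (d c : nat) (Z : nat -> nat -> nat -> Prop).
Hypotheses (Zswap12 : forall u v w, Z u v w -> Z v u w)
  (Zswap23 : forall u v w, Z u v w -> Z u w v)
  (Zdiag : forall u w, Z u u w)
  (Zcol : forall u v w, u < v < w -> triple_color u v w != c -> Z u v w)
  (Zout : forall u v w, 3 * d <= w -> Z u v w)
  (Zcollapse : forall u v w0, (forall w, w != w0 -> Z u v w) -> Z u v w0).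

Let Zrot u v w : Z u v w -> Z v w u.
Proof. by move=> /Zswap12/Zswap23. Qed.

Let Zrot2 u v w : Z u v w -> Z w u v.
Proof. by move=> /Zrot/Zrot. Qed.

Let Zfill w0 u v : (forall w, w != w0 -> Z u v w) -> forall w, Z u v w.
Proof.
by move=> H w; case: (eqVneq w w0) => [->|/H //]; apply: Zcollapse.
Qed.

Let Zcol_any u v w :
  (u < v < w -> triple_color u v w != c) ->
  (u < w < v -> triple_color u w v != c) ->
  (v < u < w -> triple_color v u w != c) ->
  (v < w < u -> triple_color v w u != c) ->
  (w < u < v -> triple_color w u v != c) ->
  (w < v < u -> triple_color w v u != c) -> Z u v w.
Proof.
move=> H1 H2 H3 H4 H5 H6.
case: (ltngtP u v) => [uv|vu|->] //; case: (ltngtP v w) => [vw|wv|E] //;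
  try (by rewrite E; apply/Zrot2/Zdiag).
- by apply: Zcol; [lia | apply: H1; lia].
- case: (ltngtP u w) => [uw|wu|->]; last by apply/Zswap23/Zdiag.
    by apply/Zswap23; apply: Zcol; [lia | apply: H2; lia].
  by apply/Zrot; apply: Zcol; [lia | apply: H5; lia].
- case: (ltngtP u w) => [uw|wu|->]; last by apply/Zswap23/Zdiag.
    by apply/Zswap12; apply: Zcol; [lia | apply: H3; lia].
  by apply/Zrot2; apply: Zcol; [lia | apply: H4; lia].
- by apply/Zswap12/Zrot/Zcol; [lia | apply: H6; lia].
Qed.

(** A triple is always colored by the block of one of its vertices. *)
Let Zother u v w : u %/ 3 != c -> v %/ 3 != c -> w %/ 3 != c -> Z u v w.
Proof.
by move=> *; apply: Zcol_any => _; rewrite /triple_color; do !case: ifP => _.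
Qed.

Ltac wrong_color :=
  apply: Zcol_any => ?; rewrite /triple_color; do !case: ifP => ?; lia.

(* In color class c, once every triple with a vertex in a later block than j > c
   is gone, every remaining triple reaching block j has an edge that lies in no
   other remaining triple. *)
Let Zstage j : c < j -> (forall u v w, j < w %/ 3 -> Z u v w) ->
  forall u v w, w %/ 3 = j -> Z u v w.
Proof.
move=> cj later.
have two u v : u %/ 3 = j -> v %/ 3 = j -> u != v -> forall w, Z u v w.
  (* The only apex of color [c] is the vertex of block [c] whose residue is missing from [u] and
     [v]: the three residues sum to 3. *)
  move=> uj vj uv; apply: (Zfill (3 * c + (3 - u %% 3 - v %% 3))) => w ww.
  have [wc|wc] := eqVneq (w %/ 3) c; last by apply: Zother; lia.
  by wrong_color.
have far u v : u %/ 3 != c -> v %/ 3 = j -> forall w, Z u v w.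
  move=> uc vj; case: (ltngtP (u %/ 3) j) => uj w.
  - move: w.
    (* Solves for the residue of [w]: [p = 1] if block [c] comes first, [p = 2] if it lies in the
       middle. *)
    apply: (Zfill (3 * c + if c < u %/ 3 then (u %% 3 + 2 + 2 * (v %% 3)) %% 3
                           else (u %% 3 + v %% 3 + 2) %% 3)) => w ww.
    have [wc|wc] := eqVneq (w %/ 3) c; last by apply: Zother; lia.
    by move: ww; case: ifP => ? ww; wrong_color.
  - by apply/Zrot2; apply: later.
  - by case: (eqVneq u v) => [->|uv]; [exact: Zdiag | exact: two].
have near u v : u %/ 3 = c -> v %/ 3 = j -> u %% 3 != v %% 3 ->
    forall w, Z u v w.
  (* The cone from [v] over an edge of block [c] has color [c] only if an end of the edge has the
     residue of [v]. *)
  move=> uc vj uv; apply: (Zfill (3 * c + v %% 3)) => w ww.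
  have [wc|wc] := eqVneq (w %/ 3) c; last by apply/Zrot2/Zswap12; apply: far.
  have [->|uw] := eqVneq u w; first by apply/Zswap23; apply: Zdiag.
  by wrong_color.
move=> u v w wj; apply/Zrot2.
have [vc|vc] := eqVneq (v %/ 3) c; last exact: far.
have [uc|uc] := eqVneq (u %/ 3) c; last by apply/Zrot2/Zswap12; apply: far.
have [vw|/near] := eqVneq (v %% 3) (w %% 3); last by apply.
have [uw|uw] := eqVneq (u %% 3) (w %% 3).
  by rewrite (_ : u = v); [apply/Zswap23/Zdiag | lia].
by apply/Zrot2/Zswap12; apply: near.
Qed.

(** The blocks after [c] are stripped from the last one downwards. *)
Let Zlater j u v w : c < j -> j <= w %/ 3 -> Z u v w.
Proof.
move=> cj; elim: {j}(d - j) {-2}j (leqnn (d - j)) cj u v w => [|n IHn] j dj cj u v w jw.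
  by apply: Zout; lia.
move: jw; rewrite leq_eqVlt => /orP[/eqP jw|jw].
  by apply: (Zstage j) => // u' v' w' jw'; apply: (IHn j.+1); lia.
by apply: (IHn j.+1); lia.
Qed.

(** After the later blocks go the triples with an edge before block [c], then those with one vertex
    before it, and finally the triangle of block [c]. *)
Lemma triple_color_collapse u v w : Z u v w.
Proof.
have later x y z : c < z %/ 3 -> Z x y z by apply: (Zlater c.+1).
have early x y : x %/ 3 < c -> y %/ 3 < c -> forall z, Z x y z.
  wlog xy : x y / x < y => [H|] xc yc.
    case: (ltngtP x y) => [xy|yx|->] z; first exact: H.
      by apply/Zswap12; apply: H.
    exact: Zdiag.
  (* For distinct blocks, this solves [p = 0] for the residue of [z]. *)
  apply: (Zfill (3 * c + if x %/ 3 == y %/ 3 then 3 - x %% 3 - y %% 3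
                         else (y %% 3 + 2 * (x %% 3)) %% 3)) => z zz.
  have [zc|zc] := eqVneq (z %/ 3) c; last by apply: Zother; lia.
  by move: zz; case: ifP => ? zz; wrong_color.
have mixed x y : x %/ 3 < c -> y %/ 3 = c -> x %% 3 != y %% 3 ->
    forall z, Z x y z.
  move=> xc yc xy; apply: (Zfill (3 * c + x %% 3)) => z zz.
  case: (ltngtP (z %/ 3) c) => zc; first by apply/Zswap23; apply: early.
    exact: later.
  have [->|yz] := eqVneq y z; first by apply/Zrot2; apply: Zdiag.
  by wrong_color.
have mixed' x y : x %/ 3 < c -> forall z, Z x y z.
  move=> xc z; case: (ltngtP (y %/ 3) c) => yc; first exact: early.
    by apply/Zswap23; apply: later.
  case: (ltngtP (z %/ 3) c) => zc; first by apply/Zswap23; apply: early.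
    exact: later.
  have [xy|/mixed] := eqVneq (x %% 3) (y %% 3); last by apply.
  have [xz|xz] := eqVneq (x %% 3) (z %% 3); last by apply/Zswap23; apply: mixed.
  by rewrite (_ : y = z); [apply/Zrot2/Zdiag | lia].
case: (ltngtP (u %/ 3) c) => uc; first exact: mixed'.
  by apply/Zrot2; apply: later.
case: (ltngtP (v %/ 3) c) => vc; first by apply/Zswap12; apply: mixed'.
  by apply/Zswap23; apply: later.
have [->|uv] := eqVneq u v; first exact: Zdiag.
move: w; apply: (Zfill (3 * c + (3 - u %% 3 - v %% 3))) => w ww.
case: (ltngtP (w %/ 3) c) => wc; first by apply/Zrot; apply: mixed'.
  exact: later.
have [->|uw] := eqVneq u w; first by apply/Zswap23; apply: Zdiag.
have -> : v = w by lia.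
by apply/Zrot2/Zdiag.
Qed.

End Collapse.

Local Open Scope ring_scope.

(** * Simplicial boundary of triples, and 2-cycles in a color class *)

Section Boundary.
Variables (k : fieldType) (n : nat).
Implicit Types t s : triple n.

Definition incidence t (e : 'I_n * 'I_n) : k :=
  (e == ((val t).1.2, (val t).2))%:R - (e == ((val t).1.1, (val t).2))%:R
  + (e == ((val t).1.1, (val t).1.2))%:R.

Definition vertices t : seq nat :=
  [:: nat_of_ord (val t).1.1; nat_of_ord (val t).1.2; nat_of_ord (val t).2].

Lemma vertices_sorted t :
  ((val t).1.1 < (val t).1.2)%N /\ ((val t).1.2 < (val t).2)%N.
Proof. exact/andP/(valP t). Qed.

Lemma incidence_vertices t e : incidence t e != 0 ->
  (nat_of_ord e.1 \in vertices t) && (nat_of_ord e.2 \in vertices t).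
Proof.
rewrite /incidence /vertices !inE.
do 3![case: (e =P _) => [->|_]; first by rewrite /= !eqxx ?orbT].
by rewrite subrr addr0 eqxx.
Qed.

Lemma incidence_neq0 t (e : 'I_n * 'I_n) : (nat_of_ord e.1 < e.2)%N ->
  (nat_of_ord e.1 \in vertices t) -> (nat_of_ord e.2 \in vertices t) ->
  incidence t e != 0.
Proof.
case: e => x y /=; have [] := vertices_sorted t.
rewrite /vertices !inE /incidence !xpair_eqE -!val_eqE /=.
case: t => [[[a b] c] /= _] ab bc xy.
have ac := ltn_trans ab bc.
have neq := (ltn_eqF ab, ltn_eqF bc, ltn_eqF ac, gtn_eqF ab, gtn_eqF bc, gtn_eqF ac).
case/or3P=> /eqP xE; case/or3P=> /eqP yE; try (exfalso; lia);
  by rewrite xE yE !(eqxx, neq) /= ?(subr0, sub0r, addr0, add0r, oppr_eq0) oner_eq0.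
Qed.

Lemma vertices_sub t (s : seq nat) : {subset vertices t <= s} ->
  [/\ nat_of_ord (val t).1.1 \in s, nat_of_ord (val t).1.2 \in s
    & nat_of_ord (val t).2 \in s].
Proof. by move=> ts; split; apply: ts; rewrite !inE eqxx ?orbT. Qed.

Lemma vertices_inj t s : {subset vertices t <= vertices s} -> t = s.
Proof.
move=> ts; apply: val_inj; have [] := vertices_sorted t; have [] := vertices_sorted s.
have [H1 H2 H3] := vertices_sub _ _ ts; rewrite !inE in H1 H2 H3.
case: t s H1 H2 H3 {ts} => [[[a b] c] /= abc] [[[x y] z] /= xyz] H1 H2 H3 *.
by congr (_, _, _); apply: val_inj => /=; lia.
Qed.

(* Z u v w says that f vanishes on the triple with vertices u, v, w. The cycle
   condition at an edge kills the last triple through it not yet known to have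
   coefficient 0, whatever the signs. *)
Lemma color_class_acyclic d (c : nat) (f : triple n -> k) :
  n = (3 * d)%N ->
  (forall t, triple_color (val t).1.1 (val t).1.2 (val t).2 != c -> f t = 0) ->
  (forall e, \sum_t f t * incidence t e = 0) ->
  forall t, f t = 0.
Proof.
move=> nd fc fe.
pose Z u v w := forall t, {subset vertices t <= [:: u; v; w]} -> f t = 0.
have Zsub u v w u' v' w' : {subset [:: u; v; w] <= [:: u'; v'; w']} ->
    Z u' v' w' -> Z u v w.
  by move=> s H t ts; apply: H => x /ts/s.
suff H : forall u v w, Z u v w by move=> t; apply: (H (val t).1.1 (val t).1.2 (val t).2).
have distinct t u v w : {subset vertices t <= [:: u; v; w]} ->
    [/\ u \in vertices t, v \in vertices t & w \in vertices t] /\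
    [/\ u != v, u != w & v != w].
  move=> ts; have [] := vertices_sorted t.
  have [H1 H2 H3] := vertices_sub _ _ ts; rewrite !inE in H1 H2 H3.
  by rewrite /vertices !inE; split; split; lia.
apply: (triple_color_collapse d c Z) => [u v w|u v w|u w|u v w uvw uvwc|u v w wd|u v w0 H].
- by apply: Zsub => x; rewrite !inE; lia.
- by apply: Zsub => x; rewrite !inE; lia.
- by move=> t /distinct[_ []]; rewrite eqxx.
- move=> t ts; apply: fc; have [t12 t23] := vertices_sorted t.
  have [H1 H2 H3] := vertices_sub _ _ ts; rewrite !inE in H1 H2 H3.
  rewrite (_ : nat_of_ord _ = u); last lia.
  rewrite (_ : nat_of_ord (val t).1.2 = v); last lia.
  by rewrite (_ : nat_of_ord (val t).2 = w); last lia.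
- move=> t /distinct[[_ _ wt] _]; move: wt; rewrite /vertices !inE.
  by case/or3P=> /eqP wE; move: wd; rewrite wE -nd leqNgt ltn_ord.
- move=> t ts; have [[ut vt wt] [uv _ _]] := distinct _ _ _ _ ts.
  have lt_vert s x : x \in vertices s -> (x < n)%N.
    by rewrite !inE => /or3P[] /eqP->.
  have xt : minn u v \in vertices t by rewrite /minn; case: ifP.
  have yt : maxn u v \in vertices t by rewrite /maxn; case: ifP.
  pose e := (Ordinal (lt_vert _ _ xt), Ordinal (lt_vert _ _ yt)).
  have te : incidence t e != 0 by apply: incidence_neq0 => //=; lia.
  have := fe e; rewrite (bigD1 t) //= big1 ?addr0 => [/eqP|s st].
    by rewrite mulf_eq0 (negPf te) orbF => /eqP.
  apply/eqP; rewrite mulf_eq0 orbC -implyNb; apply/implyP => /incidence_vertices.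
  rewrite /= => /andP[xs ys].
  have us : u \in vertices s by move: xs ys; rewrite /minn /maxn; case: ifP.
  have vs : v \in vertices s by move: xs ys; rewrite /minn /maxn; case: ifP.
  have [w ww sw] : exists2 w, w != w0 & {subset vertices s <= [:: u; v; w]}.
    have [x [xs' sx]] : exists x, x \in vertices s /\ {subset vertices s <= [:: u; v; x]}.
      have [s12 s23] := vertices_sorted s.
      exists (foldr addn 0 (vertices s) - u - v)%N; move: us vs.
      rewrite /vertices !inE /= => us vs; split; first lia.
      by move=> y; rewrite !inE; lia.
    exists x => //; apply: contraNneq st => xw0; rewrite eq_sym; apply/eqP/vertices_inj.
    move=> y /ts ytu; have /or3P : [|| y == u, y == v | y == x].
      by move: ytu; rewrite -xw0 !inE.
    by case=> /eqP->.
  by apply/eqP; exact: (H w ww s).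
Qed.

End Boundary.

Arguments incidence {k n} t e.

(** * Determinants of vector-weighted incidence matrices *)

Section WeightedIncidence.
Variables (k : fieldType) (I E : finType) (inc : I -> E -> k) (V : vectType k).
Implicit Types (v : {ffun I -> V}) (f : I -> k).

Local Notation rows := #|I|.
Local Notation cols := #|{: E * 'I_(\dim {:V})}|.

Definition weighted_row t (x : V) : 'rV[k]_cols :=
  \row_j (inc t (enum_val j).1 * coord (vbasis {:V}) (enum_val j).2 x).

Definition weighted_mx v : 'M[k]_(rows, cols) :=
  \matrix_i weighted_row (enum_val i) (v (enum_val i)).

Lemma weighted_row_linear t : linear (weighted_row t).
Proof.
by move=> a x y; apply/rowP => j; rewrite !mxE linearP mulrDr mulrCA.
Qed.

Lemma mul_weighted_mx (r : 'rV[k]_rows) v e c :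
  (r *m weighted_mx v) 0 (enum_rank (e, c)) =
  \sum_t r 0 (enum_rank t) * (inc t e * coord (vbasis {:V}) c (v t)).
Proof.
rewrite mxE (reindex enum_rank) /=; last first.
  by exists enum_val => i _; rewrite (enum_rankK, enum_valK).
by apply: eq_bigr => t _; rewrite !mxE !enum_rankK.
Qed.

Lemma weighted_mx_mulE (P : 'M[k]_(cols, rows)) v i j :
  (weighted_mx v *m P) i j =
  (weighted_row (enum_val i) (v (enum_val i)) *m P) 0 j.
Proof. by rewrite -(rowK (fun i => weighted_row _ (v _)) i) -row_mul [RHS]mxE. Qed.

(** Only row [t] of the product involves [v t], and it does so linearly. *)
Lemma det_weighted_mx_multilinear (P : 'M[k]_(cols, rows)) :
  multilinear (W := k^o) (fun v => \det (weighted_mx v *m P)).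
Proof.
move=> v t a x y /=.
have updE s w w' : s != t -> upd v t w s = upd v t w' s.
  by rewrite !ffunE => /negPf->.
have row'E w w' : row' (enum_rank t) (weighted_mx (upd v t w) *m P) =
                  row' (enum_rank t) (weighted_mx (upd v t w') *m P).
  apply/matrixP => i j; rewrite [LHS]mxE [RHS]mxE !weighted_mx_mulE.
  rewrite (updE _ w w') //; apply: contraTneq (neq_lift (enum_rank t) i) => tE.
  by rewrite -[lift _ _]enum_valK tE eqxx.
rewrite (determinant_multilinear (i0 := enum_rank t) (b := a) (c := 1)
  (A := weighted_mx (upd v t (a *: x + y)) *m P)
  (B := weighted_mx (upd v t x) *m P) (C := weighted_mx (upd v t y) *m P))
  ?mul1r //.
apply/rowP => j; rewrite scale1r ![row _ _ _ _]mxE [RHS]mxE [X in _ = X + _]mxE.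
rewrite ![row _ _ _ _]mxE !weighted_mx_mulE !ffunE enum_rankK eqxx.
by rewrite weighted_row_linear mulmxDl -scalemxAl 2!mxE.
Qed.

Lemma det_weighted_mx_eq0 (P : 'M[k]_(cols, rows)) v f t0 :
  f t0 != 0 ->
  (forall e c, \sum_t f t * (inc t e * coord (vbasis {:V}) c (v t)) = 0) ->
  \det (weighted_mx v *m P) = 0.
Proof.
move=> ft0 fv; apply/eqP/det0P; exists (\row_i f (enum_val i)).
  by apply: contraNneq ft0 => /rowP/(_ (enum_rank t0)); rewrite !mxE enum_rankK => ->.
rewrite mulmxA (_ : _ *m weighted_mx v = 0) ?mul0mx //.
apply/rowP => j; rewrite -[j]enum_valK; case: (enum_val j) => e c.
rewrite mul_weighted_mx mxE -[RHS](fv e c).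
by apply: eq_bigr => t _; rewrite mxE enum_rankK.
Qed.

(** Columns [(e, c)] meet only rows of color [c], so a relation between rows restricts to a cycle on
    each color class. *)
Lemma weighted_mx_row_free (col : {ffun I -> 'I_(\dim {:V})}) :
  (forall c f, (forall t, col t != c -> f t = 0) ->
     (forall e, \sum_t f t * inc t e = 0) -> forall t, f t = 0) ->
  row_free (weighted_mx (basis_family col)).
Proof.
move=> acyclic; rewrite -kermx_eq0; apply/eqP/row_matrixP => i; rewrite row0.
have : row i (kermx (weighted_mx (basis_family col)))
         *m weighted_mx (basis_family col) = 0.
  by rewrite -row_mul mulmx_ker row0.
set r := row i _ => rM; apply/rowP => j; rewrite [RHS]mxE.
pose f t := if col t == col (enum_val j) then r 0 (enum_rank t) else 0.
have <- : f (enum_val j) = r 0 j by rewrite /f eqxx enum_valK.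
apply: (acyclic (col (enum_val j))) => [t /negPf tc|e]; first by rewrite /f tc.
have := congr1 (fun M : 'rV_cols => M 0 (enum_rank (e, col (enum_val j)))) rM.
rewrite /= mul_weighted_mx mxE => sum0; rewrite -[RHS]sum0.
apply: eq_bigr => t _.
rewrite ffunE coord_free ?(basis_free (vbasisP _)) // /f.
by case: eqP => _; rewrite ?mulr1 // mulr0 mulr0 mul0r.
Qed.

End WeightedIncidence.

Arguments weighted_mx {k I E} inc {V} v.

(** * A linear form that kills [E_S3] but not [pure v0] *)

Lemma span_of_linear_eq0 (k : fieldType) (T : vectType k) (S : T -> Prop)
    (W : lmodType k) (g : {linear T -> W}) :
  (forall u, S u -> g u = 0) -> forall u, u \in span_of S -> g u = 0.
Proof.
move=> gS u /span_ofP[X SX]; rewrite -[X]/(val (in_tuple X)) => /coord_span->.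
rewrite linear_sum big1 // => i _; rewrite linearZ /= gS ?scaler0 //.
by apply/SX/mem_nth.
Qed.

(* The boundary of the tetrahedron xyzt is a cycle, so it gives a linear relation
   between the rows as soon as the four faces carry the same vector. *)
Lemma det_boundary_eq0 (k : fieldType) (n : nat) (V : vectType k)
    (v : {ffun triple n -> V}) P (x y z t : 'I_n)
    (xy : (x < y)%N) (yz : (y < z)%N) (zt : (z < t)%N) :
  let xz := ltn_trans xy yz in let yt := ltn_trans yz zt in
  v (tri xy yz) = v (tri xy yt) -> v (tri xy yt) = v (tri xz zt) ->
  v (tri xz zt) = v (tri yz zt) ->
  \det (weighted_mx incidence v *m P) = 0.
Proof.
move=> xz yt v1 v2 v3.
pose chi (s u : triple n) : k := (u == s)%:R.
pose f (u : triple n) := chi (tri yz zt) u - chi (tri xz zt) u + chi (tri xy yt) u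
            - chi (tri xy yz) u.
apply: (det_weighted_mx_eq0 _ _ _ _ _ _ _ f (tri xy yz)) => [|e c].
  rewrite /f /chi eqxx -!val_eqE /= !xpair_eqE -!val_eqE /= !eqxx.
  rewrite (ltn_eqF xy) (ltn_eqF yz) (ltn_eqF zt) /= !subr0 !add0r.
  by rewrite oppr_eq0 oner_eq0.
have sum_chi s (F : triple n -> k) : \sum_u chi s u * F u = F s.
  rewrite (bigD1 s) //= /chi eqxx mul1r big1 ?addr0 // => u /negPf->.
  by rewrite mul0r.
have sum_f (F : triple n -> k) : \sum_u f u * F u =
    F (tri yz zt) - F (tri xz zt) + F (tri xy yt) - F (tri xy yz).
  rewrite -!sum_chi -!sumrN -!big_split /=; apply: eq_bigr => u _.
  by rewrite /f !(mulrDl, mulNr).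
by rewrite sum_f v1 v2 v3 /incidence /=; ring.
Qed.

Theorem corollary3p9 (k : fieldType) (char0 : [pchar k] =i pred0)
  (d : nat) (d_ge1 : (1 <= d)%N)
  (V : vectType k) (dimV : \dim {:V} = d) :
  (1 <= \dim {:Lambda_S3 V (3 * d)%N})%N.
Proof.
set n := (3 * d)%N.
have color_lt (t : triple n) :
    (triple_color (val t).1.1 (val t).1.2 (val t).2 < \dim {:V})%N.
  by rewrite dimV; apply: triple_color_bound; apply: ltn_ord.
pose v0 := basis_family [ffun t => Ordinal (color_lt t)].
(* The right inverse [P] makes the determinant at [v0] equal to 1. *)
have /row_freeP[P MP] : row_free (weighted_mx incidence v0).
  apply: weighted_mx_row_free => c f fc; apply: (color_class_acyclic _ _ d c) => //.
  by move=> t tc; apply: fc; rewrite ffunE -val_eqE.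
have [g [gE _]] := tensor_universal (det_weighted_mx_multilinear _ _ _ incidence V P).
have gE_S3 : forall u, u \in E_S3 V n -> g u = 0.
  apply: span_of_linear_eq0 => _ [v [-> [x [y [z [t [xy [yz [zt [v1 v2 v3]]]]]]]]]].
  rewrite gE; exact: det_boundary_eq0 v1 v2 v3.
rewrite lt0n dimv_eq0; apply/eqP => Lambda0.
have := memvf (quotv_pi (E_S3 V n) (pure v0)); rewrite Lambda0 memv0 quotv_pi0.
by move=> /gE_S3/eqP; rewrite gE MP det1 oner_eq0.
Qed.
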